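(* Let $p,q,n\in\mathbb N$ with $p,q\geq 2$ and $M=p+q-2-2n$. The Bessel operators $\mathcal B_\lambda(e_k)=(-\lambda+2\mathbb E)\partial_k-z_k\Delta$ on $\mathbb A(J^\ast)$ are tangential to the minimal orbit, i.e. they map the ideal $\langle R^2\rangle$ of $\Gamma(\mathcal O_{\mathbb A(J^\ast)_{(0)}})$ into itself, if and only if $\lambda=2-M$.
   Context: $\mathbb N=\{0,1,2,\dots\}$. $J$ is a real super-vector space of dimension $(p+q-2|2n)$ with homogeneous basis $(e_i)$ ($|i|$ the parity of $e_i$) and a supersymmetric, non-degenerate, even bilinear form $\beta$, $\beta_{ij}=\langle e_i,e_j\rangle_\beta$, whose even part has signature $(p-1,q-1)$; $(\beta^{ij})$ is the inverse matrix. $M$ is the superdimension of $J$. $\mathbb A(J^\ast)=(\mathbb R^{p+q-2},\mathcal C^\infty\otimes\Lambda^{2n})$ is the affine superspace with coordinate functions $z_i$ (corresponding to $e_i$), where $\mathcal C^\infty$ is the sheaf of complex-valued smooth functions and $\Lambda^{2n}$ the Grassmann algebra on the odd coordinates; $\mathbb A(J^\ast)_{(0)}$ is its restriction to $\mathbb R^{p+q-2}\setminus\{0\}$. $\partial^i$ is the superderivation with $\partial^i(z_j)=\delta_{ij}$, $\partial_i=\sum_j\beta_{ij}\partial^j$, $z^j=\sum_i z_i\beta^{ij}$, $R^2=\sum_{i,j}\beta^{ij}z_iz_j$, $\mathbb E=\sum_i z^i\partial_i$, $\Delta=\sum_{i,j}\beta^{ij}\partial_i\partial_j$. $\lambda\in\mathbb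 C$ is a parameter and $k$ runs over all basis indices. $\langle R^2\rangle$ is the ideal in $\Gamma(\mathcal O_{\mathbb A(J^\ast)_{(0)}})$ generated by $R^2$; the minimal orbit $C$ is the supermanifold with underlying space $\{x\in\mathbb R^{p+q-2}\setminus\{0\}: R^2(x)=0\}$ and global sections $\Gamma(\mathcal O_{\mathbb A(J^\ast)_{(0)}})/\langle R^2\rangle$. *)

(* Defs.v *)
From HB Require Import structures.
From mathcomp Require Import all_boot all_order all_algebra ring.

Set Implicit Arguments.
Unset Strict Implicit.
Unset Printing Implicit Defensive.

Import Order.TTheory GRing.Theory Num.Theory.

Local Open Scope ring_scope.

(* An element f of the Grassmann algebra is the family of its coefficients:
   f = \sum_A f A theta_A with theta_A = theta_a1 theta_a2 ... theta_ar for
   A = {a1 < a2 < ... < ar}. *)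

Definition grassmann (K : comNzRingType) (k : nat) : Type :=
  {ffun {set 'I_k} -> K^o}.

HB.instance Definition _ (K : comNzRingType) (k : nat) :=
  GRing.Lmodule.copy (grassmann K k) {ffun {set 'I_k} -> K^o}.

Section Grassmann.
Variables (K : comNzRingType) (k : nat).
Implicit Types (A B C D : {set 'I_k}) (a b : 'I_k) (f g h : grassmann K k).

(* theta_A theta_B = (-1) ^+ inversions A B theta_(A :|: B) for disjoint A, B *)
Definition inversions A B : nat := \sum_(a in A) \sum_(b in B) (b < a).

Definition gmul f g : grassmann K k :=
  [ffun C : {set 'I_k} => \sum_(A : {set 'I_k} | A \subset C)
     (-1) ^+ inversions A (C :\: A) * (f A * g (C :\: A)) : K^o].

Definition gone : grassmann K k := [ffun A : {set 'I_k} => (A == set0)%:R : K^o].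

Lemma inversionsl A B C : A \subset B ->
  inversions B C = (inversions A C + inversions (B :\: A) C)%N.
Proof.
by move=> sAB; rewrite /inversions (big_setID A) /= (setIidPr sAB).
Qed.

Lemma inversionsr A B C : A \subset B ->
  inversions C B = (inversions C A + inversions C (B :\: A))%N.
Proof.
move=> sAB; rewrite /inversions -big_split; apply: eq_bigr => c _ /=.
by rewrite (big_setID A) /= (setIidPr sAB).
Qed.

Lemma inversions0l A : inversions set0 A = 0%N.
Proof. by rewrite /inversions big_set0. Qed.

Lemma inversions0r A : inversions A set0 = 0%N.
Proof. by rewrite /inversions big1 // => a _; rewrite big_set0. Qed.

Lemma gmulA : associative gmul.
Proof.
move=> f g h; apply/ffunP => D; rewrite !ffunE.
under eq_bigr => A _ do rewrite ffunE !mulr_sumr.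
under [RHS]eq_bigr => C _ do rewrite ffunE mulr_suml mulr_sumr.
rewrite [RHS](exchange_big_dep (fun A => A \subset D)) /=; last first.
  by move=> C A sCD sAC; apply: subset_trans sCD.
apply: eq_bigr => A sAD.
rewrite [RHS](reindex_onto (fun B => A :|: B) (fun C => C :\: A)) /=; last first.
  by move=> C /andP[_ sAC]; rewrite -{2}(setID C A) (setIidPr sAC).
rewrite [RHS](eq_bigl (fun B => (B \subset D :\: A))); last first.
  move=> B; rewrite subUset sAD subsetUl andbT subsetD /=.
  rewrite setDUl setDv set0U; congr (_ && _).
  by apply/eqP/idP => [/setDidPl|/setDidPl].
apply: eq_bigr => B sB.
have dBA : (A :|: B) :\: A = B.
  by rewrite setDUl setDv set0U; apply/setDidPl; move: sB; rewrite subsetD => /andP[].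
rewrite dBA setDDl.
rewrite (inversionsr (A := B) A sB).
rewrite (inversionsl (A := A) _ (subsetUl A B)) dBA setDDl.
by rewrite !exprD; ring.
Qed.

Lemma gmul1l : left_id gone gmul.
Proof.
move=> f; apply/ffunP => C; rewrite !ffunE (bigD1 set0) ?sub0set //=.
rewrite inversions0l setD0 ffunE eqxx !mul1r big1 ?addr0 // => A.
by rewrite ffunE => /andP[_ /negPf ->]; rewrite mul0r mulr0.
Qed.

Lemma gmul1r : right_id gone gmul.
Proof.
move=> f; apply/ffunP => C; rewrite !ffunE (bigD1 C) //=.
rewrite setDv inversions0r ffunE eqxx mul1r mulr1 big1 ?addr0 // => A.
case/andP=> sAC neAC; rewrite ffunE setD_eq0.
have /negPf -> : ~~ (C \subset A).
  by apply: contra neAC => sCA; rewrite eqEsubset sAC.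
by rewrite !mulr0.
Qed.

Lemma gmulDl : left_distributive gmul +%R.
Proof.
move=> f g h; apply/ffunP => C; rewrite !ffunE -big_split.
by apply: eq_bigr => A _; rewrite ffunE mulrDl mulrDr.
Qed.

Lemma gmulDr : right_distributive gmul +%R.
Proof.
move=> f g h; apply/ffunP => C; rewrite !ffunE -big_split.
by apply: eq_bigr => A _; rewrite ffunE !mulrDr.
Qed.

Lemma gone_neq0 : gone != 0.
Proof.
by apply/eqP => /ffunP/(_ set0)/eqP; rewrite !ffunE eqxx oner_eq0.
Qed.

HB.instance Definition _ := GRing.Zmodule_isNzRing.Build (grassmann K k)
  gmulA gmul1l gmul1r gmulDl gmulDr gone_neq0.

Lemma gscaleAl (c : K) f g : c *: (f * g) = (c *: f) * g.
Proof.
apply/ffunP => C; rewrite !ffunE scaler_sumr.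
by apply: eq_bigr => A _; rewrite !ffunE /GRing.scale /=; ring.
Qed.

Lemma gscaleAr (c : K) f g : c *: (f * g) = f * (c *: g).
Proof.
apply/ffunP => C; rewrite !ffunE scaler_sumr.
by apply: eq_bigr => A _; rewrite !ffunE /GRing.scale /=; ring.
Qed.

HB.instance Definition _ :=
  GRing.Lmodule_isLalgebra.Build K (grassmann K k) gscaleAl.
HB.instance Definition _ :=
  GRing.Lalgebra_isAlgebra.Build K (grassmann K k) gscaleAr.

Lemma gscaleE (c : K) f A : (c *: f) A = c * f A.
Proof. by rewrite ffunE. Qed.

Lemma goneE A : (1 : grassmann K k) A = (A == set0)%:R.
Proof. by rewrite ffunE. Qed.

Definition theta b : grassmann K k := [ffun A : {set 'I_k} => (A == [set b])%:R : K^o].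

(* The grading automorphism, f |-> (-1)^|f| f on homogeneous f. *)
Definition gsign f : grassmann K k :=
  [ffun A : {set 'I_k} => (-1) ^+ #|A| * f A : K^o].

(* The odd derivation d/dtheta_b acting from the left: if b is not in A,
   theta_(b |: A) = (-1) ^+ #{a in A | a < b} theta_b theta_A. *)
Definition gderiv b f : grassmann K k :=
  [ffun A : {set 'I_k} =>
     if b \in A then 0 else (-1) ^+ #|[set a in A | (a < b)%N]| * f (b |: A) : K^o].

Lemma theta_mul b f C : (theta b * f) C =
  if b \in C then (-1) ^+ inversions [set b] (C :\ b) * f (C :\ b) else 0.
Proof.
rewrite ffunE; case: ifPn => [bC | bNC].
  rewrite (bigD1 [set b]) ?sub1set //= ffunE eqxx mul1r big1 ?addr0 // => A.
  by case/andP=> _ /negPf neA; rewrite ffunE neA mul0r mulr0.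
rewrite big1 // => A sAC; rewrite ffunE; case: eqP => [eA | _].
  by rewrite -sub1set -eA sAC in bNC.
by rewrite mul0r mulr0.
Qed.

Lemma inversions11 a b : inversions [set a] [set b] = (b < a)%N.
Proof. by rewrite /inversions !big_set1. Qed.

Lemma theta_anticomm a b : theta a * theta b = - (theta b * theta a).
Proof.
have coefE c d C : (theta c * theta d) C =
    if (c != d) && (C == [set c; d]) then (-1) ^+ (d < c)%N else 0.
  rewrite theta_mul ffunE; case: ifPn => [cC | cNC]; last first.
    by case: (C =P _) => [eC | _]; [rewrite eC set21 in cNC | rewrite andbF].
  have -> : (C :\ c == [set d]) = (c != d) && (C == [set c; d]).
    apply/eqP/andP => [eC | [cd /eqP->]].
      have: c \notin [set d] by rewrite -eC setD11.
      by rewrite in_set1 => ->; split=> //; rewrite -eC setD1K.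
    by rewrite setU1K // in_set1.
  case: ifP => [/andP[cd /eqP->] | _]; last by rewrite mulr0.
  by rewrite mulr1 setU1K ?in_set1 // inversions11.
apply/ffunP => C; rewrite [RHS]ffunE !coefE (eq_sym b) (setUC [set b]).
case: ifP => [/andP[ab _] | _]; last by rewrite oppr0.
by case: (ltngtP a b) ab => [||/val_inj ->]; rewrite ?eqxx ?expr0 ?expr1 ?opprK.
Qed.

Lemma gderiv_theta a b : gderiv a (theta b) = (a == b)%:R.
Proof.
have -> : (a == b)%:R = (a == b)%:R *: gone :> grassmann K k.
  by case: eqP; rewrite ?scale1r ?scale0r.
apply/ffunP => A; rewrite !ffunE /GRing.scale /=; case: ifPn => [aA | aNA].
  by case: (A =P _) => [eA | _]; [rewrite eA inE in aA | rewrite mulr0].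
have -> : (a |: A == [set b]) = (a == b) && (A == set0).
  apply/eqP/andP => [eA | [/eqP-> /eqP->]]; last by rewrite setU0.
  have ab : a = b by apply/set1P; rewrite -eA setU11.
  by rewrite ab eqxx -(setU1K aNA) eA ab setDv eqxx.
case: (altP (A =P set0)) => [-> | _]; last by rewrite andbF !mulr0.
rewrite (_ : [set _ in _ | _] = set0) ?cards0 ?andbT ?mul1r ?mulr1 //.
by apply/setP => x; rewrite !inE.
Qed.

Lemma inversions1l b B : inversions [set b] B = #|[set a in B | (a < b)%N]|.
Proof.
rewrite /inversions big_set1 -sum1_card big_mkcond [RHS]big_mkcond /=.
by apply: eq_bigr => i _; rewrite inE; case: (i \in B); case: (i < b)%N.
Qed.

Lemma inversions1r b A : b \notin A ->
  (#|[set a in A | (a < b)%N]| + inversions A [set b] = #|A|)%N.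
Proof.
move=> bA; rewrite -[RHS]sum1_card -sum1_card /inversions.
rewrite big_mkcond [X in (_ + X)%N]big_mkcond [RHS]big_mkcond -big_split /=.
apply: eq_bigr => i _; rewrite !inE big_set1; case: (boolP (i \in A)) => //= iA.
by case: (ltngtP i b) => // /val_inj ib; rewrite -ib iA in bA.
Qed.

Lemma gderiv_scalar b (c : K) : gderiv b c%:A = 0.
Proof.
apply/ffunP => A; rewrite !ffunE; case: ifP => // _.
rewrite (_ : b |: A == set0 = false) ?mulr0 /GRing.scale /= ?mulr0 //.
by apply/eqP => /setP/(_ b); rewrite !inE eqxx.
Qed.

Lemma sumU1 (P : {set 'I_k} -> K) b A : b \notin A ->
  \sum_(C : {set 'I_k} | C \subset b |: A) P C =
  \sum_(C : {set 'I_k} | C \subset A) (P C + P (b |: C)).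
Proof.
move=> bA; rewrite big_split (bigID (fun C : {set _} => b \in C)) /= addrC.
congr (_ + _).
  by apply: eq_bigl => C; rewrite -subsetD1 setU1K.
rewrite (reindex_onto (fun C => b |: C) (fun C => C :\ b)) /=; last first.
  by move=> C /andP[_ bC]; rewrite setD1K.
apply: eq_bigl => C; rewrite setU11 andbT.
apply/andP/idP => [[sC /eqP eC]|sC].
  by rewrite -eC subDset.
split; first exact: setUS.
rewrite setU1K //; apply: contra bA; exact: (subsetP sC).
Qed.

Lemma gderivM b f g : gderiv b (f * g) = gderiv b f * g + gsign f * gderiv b g.
Proof.
apply/ffunP => A; rewrite !ffunE; case: ifPn => [bA | bNA].
  rewrite -big_split -(setD1K bA).
  have: b \notin A :\ b by rewrite setD11.
  move: (A :\ b) => B bB.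
  rewrite sumU1 // big1 // => C sC; rewrite !ffunE.
  have bC : b \notin C by apply: contra bB; exact: (subsetP sC).
  have eD : (b |: B) :\: C = b |: (B :\: C).
    rewrite setDUl; congr (_ :|: _); apply/setDidPl.
    by rewrite disjoints1.
  have eD' : (b |: B) :\: (b |: C) = B :\: C.
    apply/setP => x; rewrite !inE negb_or.
    by case: eqP => [->|] //=; rewrite (negPf bB) andbF.
  have bD : b \notin B :\: C by rewrite inE (negPf bB) andbF.
  rewrite eD eD' !setU11 (negPf bC) (negPf bD) /=.
  rewrite cardsU1 bC -(inversions1r bC).
  rewrite (@inversionsr [set b] (b |: (B :\: C)) C) ?subsetUl //.
  rewrite (@inversionsl [set b] (b |: C)) ?subsetUl //.
  have -> : (b |: (B :\: C)) :\: [set b] = B :\: C.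
    by rewrite setU1K // inE (negPf bB) andbF.
  rewrite (setU1K bC) inversions1l !exprD !mulr0 !mul0r.
  set x := (-1) ^+ #|_| ; set y := (-1) ^+ #|_| ; set u := (-1) ^+ _.
  set w := (-1) ^+ _.
  have xx : x * x = 1 by rewrite -expr2 sqrr_sign.
  have yy : y * y = 1 by rewrite -expr2 sqrr_sign.
  have signE (F G : K) : u * w * (y * F * G) + 0 +
      (x * w * 0 + x * w * ((-1) ^+ true * (y * u) * F * (x * G))) = 0.
    transitivity (u * w * y * F * G * (1 - x * x)); first by ring.
    by rewrite xx subrr mulr0.
  exact: signE.
rewrite sumU1 // mulr_sumr -big_split; apply: eq_bigr => C sC.
have bC : b \notin C by apply: contra bNA; exact: (subsetP sC).
rewrite !ffunE !inE (negPf bNA) andbF (negPf bC).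
have bD : b \notin A :\: C by rewrite inE (negPf bNA) andbF.
have eD : (b |: A) :\: C = b |: (A :\: C).
  rewrite setDUl; congr (_ :|: _); apply/setDidPl.
  by rewrite disjoints1.
have eD' : (b |: A) :\: (b |: C) = A :\: C.
  apply/setP => x; rewrite !inE negb_or.
  by case: eqP => [->|] //=; rewrite (negPf bNA) andbF.
rewrite eD eD' -(inversions1r bC).
rewrite (@inversionsr [set b] (b |: (A :\: C)) C) ?subsetUl //.
rewrite (@inversionsl [set b] (b |: C)) ?subsetUl //.
rewrite (setU1K bC) (setU1K bD) inversions1l.
have -> : #|[set a in A | (a < b)%N]| =
  (#|[set a in C | (a < b)%N]| + #|[set a in A :\: C | (a < b)%N]|)%N.
  by rewrite -!inversions1l (inversionsr _ sC).
rewrite !exprD.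
set x := (-1) ^+ #|_| ; set y := (-1) ^+ #|_| ; set u := (-1) ^+ _.
set w := (-1) ^+ _.
have xx : x * x = 1 by rewrite -expr2 sqrr_sign.
have yy : y * y = 1 by rewrite -expr2 sqrr_sign.
have signE (f0 f1 g0 g1 : K) :
    x * y * (u * w * (f0 * g1) + y * w * (f1 * g0)) =
    w * (x * f1 * g0) + w * (x * u * f0 * (y * g1)).
  transitivity (x * y * u * w * f0 * g1 + x * w * f1 * g0 * (y * y)); first by ring.
  by rewrite yy mulr1; ring.
exact: signE.
Qed.
End Grassmann.

From mathcomp Require Import complex.
From mathcomp Require Import all_classical all_reals all_analysis.
Import numFieldNormedType.Exports.

Local Open Scope classical_set_scope.
Local Open Scope complex_scope.
Local Open Scope ring_scope.

(* hpart false is the even part, hpart true the odd part. *)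
Record superspace (F : fieldType) := Superspace {
  carrier :> vectType F;
  hpart : bool -> {vspace carrier};
  hpart_add : (hpart false + hpart true)%VS = fullv;
  hpart_cap : (hpart false :&: hpart true)%VS = 0%VS }.

Section Forms.
Variables (R : realType) (J : superspace R).
Implicit Type b : {biscalar J}.

Definition supersymmetric b := forall s t (u v : J),
  u \in hpart J s -> v \in hpart J t -> b u v = (-1) ^+ (s && t) * b v u.

Definition even_form b := forall s t (u v : J),
  u \in hpart J s -> v \in hpart J t -> s != t -> b u v = 0.

Definition nondegenerate_form b :=
  forall u : J, (forall v : J, b u v = 0) -> u = 0.

Definition signature b (V : {vspace J}) (r s : nat) :=
  exists2 f : (r + s).-tuple J, basis_of V f &
  forall i j : 'I_(r + s), b (tnth f i) (tnth f j) =
    if i == j then (if (i < r)%N then 1 else -1) else 0.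

(* The even vectors come first, so that |e_i| is odd iff m <= i. *)
Definition homogeneous_basis (m k : nat) (e : (m + k).-tuple J) :=
  basis_of fullv e /\
  forall i : 'I_(m + k), tnth e i \in hpart J (m <= i)%N.

Definition gram b (N : nat) (e : N.-tuple J) : 'M[R]_N :=
  \matrix_(i, j) b (tnth e i) (tnth e j).

End Forms.

Section Smooth.
Variables (R : realType) (m : nat).
Implicit Types (U : set 'rV[R]_m) (r : nat).

(* f is C^r on U (meant for open U; values of f outside U are irrelevant). *)
Fixpoint Cr_on r U (f : 'rV[R]_m -> R) : Prop :=
  (forall x, U x -> {for x, continuous f}) /\
  if r is r'.+1 then
    forall a : 'I_m, (forall x, U x -> derivable f x (delta_mx 0 a)) /\
                     Cr_on r' U (fun x => 'D_(delta_mx 0 a) f x)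
  else True.

Definition smooth_on U (f : 'rV[R]_m -> R[i]) :=
  forall r, Cr_on r U (fun x => complex.Re (f x)) /\
            Cr_on r U (fun x => complex.Im (f x)).

Definition pderiv (a : 'I_m) (f : 'rV[R]_m -> R[i]) : 'rV[R]_m -> R[i] :=
  fun x => 'D_(delta_mx 0 a) (fun y => complex.Re (f y)) x +i*
           'D_(delta_mx 0 a) (fun y => complex.Im (f y)) x.

Definition Cderivable (a : 'I_m) (f : 'rV[R]_m -> R[i]) x :=
  derivable (fun y => complex.Re (f y)) x (delta_mx 0 a) /\
  derivable (fun y => complex.Im (f y)) x (delta_mx 0 a).

End Smooth.

(* Sections of the structure sheaf of the affine superspace of dimension
   (m | k) over an open set U of R^m are the maps smooth on U with values in
   the Grassmann algebra, two of them being identified when they agree on U. *)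
Notation superfun R m k := ('rV[R]_m -> grassmann R[i] k).

(* Index positions: zlow i is z_i, zup j is z^j, dup i is the superderivation
   d^i with d^i(z_j) = delta_ij, and dlow i is d_i = \sum_j beta_ij d^j. *)

Section Superfunctions.
Variables (R : realType) (m k : nat).
Implicit Types (F G : superfun R m k) (U : set 'rV[R]_m) (i j : 'I_(m + k)).

Definition section_on U F := forall A, smooth_on U (fun x => F x A).

(* Membership in the two-sided ideal generated by G. *)
Definition in_ideal_on U G F :=
  section_on U F /\
  exists r (A B : 'I_r -> superfun R m k),
    (forall l, section_on U (A l) /\ section_on U (B l)) /\
    forall x, U x -> F x = (\sum_l A l * G * B l) x.

Definition zlow i : superfun R m k :=
  match fintype.split i with
  | inl a => fun x => ((x 0 a)%:C)%:A
  | inr c => fun _ => theta R[i] c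
  end.

Definition dup i F : superfun R m k :=
  match fintype.split i with
  | inl a => fun x => [ffun A => pderiv a (fun y => F y A) x : R[i]^o]
  | inr c => fun x => gderiv c (F x)
  end.

Lemma is_derive_coord (a c : 'I_m) (x : 'rV[R]_m) :
  is_derive x (delta_mx 0 a) (fun y : 'rV[R]_m => y 0 c) ((a == c)%:R : R).
Proof.
have cvgq : (fun h : R => h^-1 *: (((fun y : 'rV[R]_m => y 0 c) \o shift x)
    (h *: delta_mx 0 a) - x 0 c)) @ 0^' --> ((a == c)%:R : R).
  apply: cvg_near_cst; near=> h.
  have h0 : h != 0 by near: h; exact: nbhs_dnbhs_neq.
  by rewrite /= !mxE eqxx /= addrK /GRing.scale /= mulKf // eq_sym.
by apply: DeriveDef; [apply/cvg_ex; exists (a == c)%:R | exact: cvg_lim].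
Unshelve. all: by end_near. Qed.

Lemma pderiv_cst (a : 'I_m) (c : R[i]) x : pderiv a (fun=> c) x = 0.
Proof. by rewrite /pderiv !derive_cst. Qed.

Lemma pderiv_real (a : 'I_m) (f : 'rV[R]_m -> R) x d :
  is_derive x (delta_mx 0 a) f d -> pderiv a (fun y => (f y)%:C) x = d%:C.
Proof. by move=> fd; rewrite /pderiv /= derive_val derive_cst. Qed.

Lemma natr_dup_zlow (B : bool) x : (B%:R : superfun R m k) x = B%:R.
Proof. by case: B. Qed.

Lemma dup_zlow i j : dup i (zlow j) = (i == j)%:R.
Proof.
rewrite -(fintype.splitK i) -(fintype.splitK j) (inj_eq (can_inj (@unsplitK m k))).
rewrite /dup /zlow !unsplitK.
case: (fintype.split i) => [a|c]; case: (fintype.split j) => [a'|c'];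
  apply/funext => x; rewrite natr_dup_zlow.
- apply/ffunP => A; rewrite ffunE.
  have -> : ((inl a : 'I_m + 'I_k)%type == inl a')%:R =
      (a == a')%:R *: 1 :> grassmann R[i] k.
    by rewrite (inj_eq (can_inj (g := fun s => if s is inl b then b else a) _)) //;
       case: eqP; rewrite ?scale1r ?scale0r.
  rewrite gscaleE goneE.
  have -> : (fun y : 'rV[R]_m => ((y 0 a')%:C%:A : grassmann R[i] k) A) =
      fun y => (y 0 a' * (A == finset.set0)%:R)%:C.
    by apply/funext => y; rewrite gscaleE goneE rmorphM rmorph_nat.
  have dF : is_derive x (delta_mx 0 a)
      (fun y : 'rV[R]_m => y 0 a' * (A == finset.set0)%:R)
      ((a == a')%:R * (A == finset.set0)%:R).
    rewrite mulrC (_ : (fun _ => _) =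
      (A == finset.set0)%:R \*: (fun y : 'rV[R]_m => y 0 a')).
      by apply: is_deriveZ; exact: is_derive_coord.
    by apply/funext => y /=; rewrite mulrC.
  by rewrite (pderiv_real dF) rmorphM !rmorph_nat.
- by apply/ffunP => A; rewrite !ffunE /pderiv !derive_cst.
- by rewrite gderiv_scalar.
- by rewrite gderiv_theta.
Qed.

Lemma pderivD (a : 'I_m) (f g : 'rV[R]_m -> R[i]) x :
  Cderivable a f x -> Cderivable a g x ->
  Cderivable a (fun y => f y + g y) x /\
  pderiv a (fun y => f y + g y) x = pderiv a f x + pderiv a g x.
Proof.
move=> [f1 f2] [g1 g2]; rewrite /Cderivable /pderiv.
have -> : (fun y => complex.Re (f y + g y)) =
    (fun y => complex.Re (f y)) + (fun y => complex.Re (g y)).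
  by apply/funext => y; rewrite fctE; case: (f y) => ? ?; case: (g y) => ? ?.
have -> : (fun y => complex.Im (f y + g y)) =
    (fun y => complex.Im (f y)) + (fun y => complex.Im (g y)).
  by apply/funext => y; rewrite fctE; case: (f y) => ? ?; case: (g y) => ? ?.
rewrite (deriveD f1 g1) (deriveD f2 g2).
split; last by [].
by split; [exact: (derivableD f1 g1) | exact: (derivableD f2 g2)].
Qed.

Lemma pderivM (a : 'I_m) (f g : 'rV[R]_m -> R[i]) x :
  Cderivable a f x -> Cderivable a g x ->
  Cderivable a (fun y => f y * g y) x /\
  pderiv a (fun y => f y * g y) x = pderiv a f x * g x + f x * pderiv a g x.
Proof.
move=> [f1 f2] [g1 g2]; rewrite /Cderivable /pderiv.
have -> : (fun y => complex.Re (f y * g y)) =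
    (fun y => complex.Re (f y)) * (fun y => complex.Re (g y)) -
    (fun y => complex.Im (f y)) * (fun y => complex.Im (g y)).
  by apply/funext => y; rewrite !fctE; case: (f y) => ? ?; case: (g y) => ? ?.
have -> : (fun y => complex.Im (f y * g y)) =
    (fun y => complex.Re (f y)) * (fun y => complex.Im (g y)) +
    (fun y => complex.Im (f y)) * (fun y => complex.Re (g y)).
  by apply/funext => y; rewrite !fctE; case: (f y) => ? ?; case: (g y) => ? ?.
have [d11 d22] := (derivableM f1 g1, derivableM f2 g2).
have [d12 d21] := (derivableM f1 g2, derivableM f2 g1).
rewrite (deriveB d11 d22) (deriveD d12 d21).
rewrite (deriveM f1 g1) (deriveM f2 g2) (deriveM f1 g2) (deriveM f2 g1).
split; first by split; [exact: (derivableB d11 d22) | exact: (derivableD d12 d21)].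
have mulE (a1 a2 b1 b2 c1 c2 d1 d2 : R) :
    (a1 * d1 + c1 * b1 - (a2 * d2 + c2 * b2)) +i*
    (a1 * d2 + c2 * b1 + (a2 * d1 + c1 * b2)) =
    (b1 +i* b2) * (c1 +i* c2) + (a1 +i* a2) * (d1 +i* d2).
  by apply/eqP; rewrite eq_complex /=; apply/andP; split; apply/eqP; ring.
rewrite {}/GRing.scale /= mulE; congr (_ * _ + _ * _).
  by case: (g x).
by case: (f x).
Qed.

Lemma pderiv_sum (I : Type) (r : seq I) (P : pred I) (a : 'I_m)
    (f : I -> 'rV[R]_m -> R[i]) x :
  (forall l, P l -> Cderivable a (f l) x) ->
  Cderivable a (fun y => \sum_(l <- r | P l) f l y) x /\
  pderiv a (fun y => \sum_(l <- r | P l) f l y) x =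
  \sum_(l <- r | P l) pderiv a (f l) x.
Proof.
move=> df; elim: r => [|l r [IH1 IH2]].
  rewrite big_nil (_ : (fun _ => _) = fun=> 0).
    by rewrite /Cderivable /pderiv !derive_cst.
  by apply/funext => y; rewrite big_nil.
rewrite big_cons; case: (boolP (P l)) => Pl; last first.
  rewrite (_ : (fun _ => _) = fun y => \sum_(l <- r | P l) f l y) //.
  by apply/funext => y; rewrite big_cons (negPf Pl).
rewrite (_ : (fun _ => _) = fun y => f l y + \sum_(l <- r | P l) f l y).
  by have [? ->] := pderivD (df l Pl) IH1; rewrite IH2.
by apply/funext => y; rewrite big_cons Pl.
Qed.

(* dup i has the parity of i: even for i < m, odd otherwise. *)
Lemma dupM U i F G x : section_on U F -> section_on U G -> U x ->
  dup i (F * G) x =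
  dup i F x * G x + (if (m <= i)%N then gsign (F x) else F x) * dup i G x.
Proof.
move=> sF sG Ux; rewrite /dup; case: fintype.splitP => [a ia | c ic]; last first.
  by rewrite ic leq_addr gderivM.
rewrite ia leqNgt ltn_ord /=; apply/ffunP => A; rewrite !ffunE.
have dF C : Cderivable a (fun y => F y C) x.
  have [[_ /(_ a)[d1 _]] [_ /(_ a)[d2 _]]] := sF C 1%N.
  by split; [exact: d1 | exact: d2].
have dG C : Cderivable a (fun y => G y C) x.
  have [[_ /(_ a)[d1 _]] [_ /(_ a)[d2 _]]] := sG C 1%N.
  by split; [exact: d1 | exact: d2].
have dc (c : R[i]) : Cderivable a (fun=> c) x by split; exact: derivable_cst.
have -> : (fun y => (F * G) y A) = fun y =>
    \sum_(C : {set 'I_k} | C \subset A)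
      (-1) ^+ inversions C (A :\: C) * (F y C * G y (A :\: C)).
  by apply/funext => y; rewrite ffunE.
have dFG C := proj1 (pderivM (dF C) (dG (A :\: C))).
have dt C := proj1 (pderivM (dc ((-1) ^+ inversions C (A :\: C))) (dFG C)).
have [_ ->] := @pderiv_sum {set 'I_k} (index_enum _) (fun C => C \subset A)
  a _ x (fun C _ => dt C).
rewrite -big_split; apply: eq_bigr => C _ /=.
have [_ eFG] := pderivM (dF C) (dG (A :\: C)).
have [_ ->] := pderivM (dc ((-1) ^+ inversions C (A :\: C))) (dFG C).
by rewrite eFG pderiv_cst mul0r add0r mulrDr !ffunE.
Qed.


Variable beta : 'M[R]_(m + k).
Local Notation betaV := (invmx beta).

Definition dlow i F : superfun R m k := \sum_j (beta i j)%:C *: dup j F.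

Definition zup j : superfun R m k := \sum_i (betaV i j)%:C *: zlow i.

Definition R2 : superfun R m k :=
  \sum_i \sum_j (betaV i j)%:C *: (zlow i * zlow j).

Definition euler F : superfun R m k := \sum_i zup i * dlow i F.

Definition laplacian F : superfun R m k :=
  \sum_i \sum_j (betaV i j)%:C *: dlow i (dlow j F).

Definition bessel (lambda : R[i]) i F : superfun R m k :=
  - lambda *: dlow i F + 2 *: euler (dlow i F) - zlow i * laplacian F.

End Superfunctions.

(* Main.v *)
Require Import Defs.
From mathcomp Require Import all_boot all_order all_algebra ring.
From mathcomp Require Import complex.
From mathcomp Require Import all_classical all_reals all_analysis.

Set Implicit Arguments.
Unset Strict Implicit.
Unset Printing Implicit Defensive.

Import Order.TTheory GRing.Theory Num.Theory.
Import numFieldNormedType.Exports.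

Local Open Scope classical_set_scope.
Local Open Scope ring_scope.

(** The superderivations satisfy [dlow l R2 = 2 z_l], so the Euler field
    multiplies [R2] by 2 and the Laplacian maps it to twice the superdimension
    m - k of the space (M in the theorem). As [R2] is even and central, the
    Leibniz rule then gives, with the terms z_l E F cancelling,
      B_lambda(e_l) (R2 F)
        = 2 (2 - M - lambda) z_l F + R2 B_(lambda - 4)(e_l) F,
    which is [bessel_R2M]. The ideal of [R2] consists of the products R2 G
    ([in_ideal_R2P]). Hence for lambda = 2 - M the error term vanishes and the
    ideal is preserved ([bessel_tangential]).

    Conversely, apply the identity to F = 1: tangentiality puts
    2 (2 - M - lambda) z_l into the ideal. The body (the coefficient of 1 in
    the Grassmann algebra) of an element of the ideal vanishes where the body
    of [R2] does. Since p, q >= 2, both signs occur in the signature, so the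
    even part of J has a nonzero null vector, and its coordinates give a point
    x <> 0 at which the body of [R2] is zero ([null_point]). Some even
    coordinate z_l is nonzero there, so that 2 - M - lambda = 0
    ([tangential_parameter]). *)

(** * Smooth functions on an open set *)

Section SmoothClosure.
Variables (R : realType) (m : nat).
Implicit Types (U : set 'rV[R]_m) (r : nat).

Lemma near_eq_on (T : Type) U (f g : 'rV[R]_m -> T) x : open U -> U x ->
  (forall y, U y -> f y = g y) -> {near x, f =1 g}.
Proof.
move=> oU Ux fg; near=> y; apply: fg; near: y; exact: open_nbhs_nbhs.
Unshelve. all: by end_near. Qed.

Lemma continuous_on_ext U (f g : 'rV[R]_m -> R) : open U ->
  (forall x, U x -> f x = g x) -> (forall x, U x -> {for x, continuous f}) ->
  forall x, U x -> {for x, continuous g}.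
Proof.
move=> oU fg cf x Ux; rewrite /prop_for /continuous_at -(fg _ Ux).
exact: cvg_trans (near_eq_cvg (near_eq_on oU Ux fg)) (cf x Ux).
Qed.

(** The values of a function off [U] must not matter, because superfunctions
    are only identified on [U]; openness makes the derivatives agree too. *)
Lemma Cr_on_ext r U (f g : 'rV[R]_m -> R) : open U ->
  (forall x, U x -> f x = g x) -> Cr_on r U f -> Cr_on r U g.
Proof.
move=> oU; elim: r f g => [|r IH] f g fg [cf df].
  by split=> //; exact: continuous_on_ext cf.
split=> [|a]; first exact: continuous_on_ext cf.
have [dfa Cfa] := df a; split=> [x Ux|].
  exact: near_eq_derivable (near_eq_on oU Ux fg) (dfa x Ux).
by apply: IH Cfa => x Ux; exact: near_eq_derive (near_eq_on oU Ux fg).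
Qed.

(** Used in the Leibniz rule, where the undifferentiated factor has one degree
    of smoothness more than the product needs. *)
Lemma Cr_on_pred r U (f : 'rV[R]_m -> R) : Cr_on r.+1 U f -> Cr_on r U f.
Proof.
elim: r f => [|r IH] f [cf df]; first by [].
by split=> // a; have [dfa Cfa] := df a; split=> //; exact: IH.
Qed.

Lemma Cr_on_cst r U (c : R) : Cr_on r U (fun=> c).
Proof.
elim: r c => [|r IH] c; first by split=> // x Ux; exact: cst_continuous.
split=> [x Ux|a]; first exact: cst_continuous.
split=> [x Ux|]; first exact: derivable_cst.
rewrite (_ : (fun x => 'D__ _ x) = fun=> 0); first exact: IH.
by apply/funext => x; exact: derive_cst.
Qed.

Lemma Cr_on_coord r U (c : 'I_m) : Cr_on r U (fun x => x 0 c).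
Proof.
case: r => [|r]; first by split=> // x Ux; exact: coord_continuous.
split=> [x Ux|a]; first exact: coord_continuous.
split=> [x Ux|]; first by have [] := is_derive_coord a c x.
rewrite (_ : (fun x => 'D__ _ x) = fun=> (a == c)%:R : R); first exact: Cr_on_cst.
by apply/funext => x; have [_] := is_derive_coord a c x.
Qed.

Lemma Cr_onD r U (f g : 'rV[R]_m -> R) : open U ->
  Cr_on r U f -> Cr_on r U g -> Cr_on r U (f + g).
Proof.
move=> oU; elim: r f g => [|r IH] f g [cf df] [cg dg].
  by split=> // x Ux; apply: continuousD; [exact: cf | exact: cg].
split=> [x Ux|a]; first by apply: continuousD; [exact: cf | exact: cg].
have [[dfa Cfa] [dga Cga]] := (df a, dg a); split=> [x Ux|].
  by apply: derivableD; [exact: dfa | exact: dga].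
apply: (Cr_on_ext oU _ (IH _ _ Cfa Cga)) => x Ux.
by rewrite deriveD; [| exact: dfa | exact: dga].
Qed.

Lemma Cr_onM r U (f g : 'rV[R]_m -> R) : open U ->
  Cr_on r U f -> Cr_on r U g -> Cr_on r U (f * g).
Proof.
move=> oU; elim: r f g => [|r IH] f g Crf Crg.
  have [[cf df] [cg dg]] := (Crf, Crg).
  by split=> // x Ux; apply: continuousM; [exact: cf | exact: cg].
have [[cf df] [cg dg]] := (Crf, Crg).
split=> [x Ux|a]; first by apply: continuousM; [exact: cf | exact: cg].
have [[dfa Cfa] [dga Cga]] := (df a, dg a); split=> [x Ux|].
  by apply: derivableM; [exact: dfa | exact: dga].
have Cf := Cr_on_pred Crf; have Cg := Cr_on_pred Crg.
apply: (Cr_on_ext oU _ (Cr_onD oU (IH _ _ Cf Cga) (IH _ _ Cg Cfa))) => x Ux.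
by rewrite deriveM; [| exact: dfa | exact: dga].
Qed.

Lemma Cr_onN r U (f : 'rV[R]_m -> R) : open U -> Cr_on r U f -> Cr_on r U (- f).
Proof.
move=> oU Cf; apply: (Cr_on_ext oU _ (Cr_onM oU (Cr_on_cst r U (-1)) Cf)) => x _.
by rewrite fctE mulN1r.
Qed.

Lemma smooth_on_cst U (c : R[i]) : smooth_on U (fun=> c).
Proof. by move=> r; split; exact: Cr_on_cst. Qed.

Lemma smooth_on_coord U (c : 'I_m) : smooth_on U (fun x => (x 0 c)%:C%C).
Proof. by move=> r; split; [exact: Cr_on_coord | exact: Cr_on_cst]. Qed.

Lemma smooth_onD U (f g : 'rV[R]_m -> R[i]) : open U ->
  smooth_on U f -> smooth_on U g -> smooth_on U (fun x => f x + g x).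
Proof.
move=> oU sf sg r; have [[f1 f2] [g1 g2]] := (sf r, sg r).
by split; [apply: (Cr_on_ext oU _ (Cr_onD oU f1 g1)) |
           apply: (Cr_on_ext oU _ (Cr_onD oU f2 g2))] => x _;
   rewrite fctE; case: (f x) => ? ?; case: (g x).
Qed.

Lemma smooth_onM U (f g : 'rV[R]_m -> R[i]) : open U ->
  smooth_on U f -> smooth_on U g -> smooth_on U (fun x => f x * g x).
Proof.
move=> oU sf sg r; have [[f1 f2] [g1 g2]] := (sf r, sg r).
have CM := fun h1 h2 => @Cr_onM r U h1 h2 oU.
have CD := fun h1 h2 => @Cr_onD r U h1 h2 oU.
split; [apply: (Cr_on_ext oU _ (CD _ _ (CM _ _ f1 g1) (Cr_onN oU (CM _ _ f2 g2)))) |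
        apply: (Cr_on_ext oU _ (CD _ _ (CM _ _ f1 g2) (CM _ _ f2 g1)))] => x _;
  by rewrite !fctE; case: (f x) => ? ?; case: (g x).
Qed.

Lemma smooth_on_sum U (I : Type) (s : seq I) (P : pred I)
    (f : I -> 'rV[R]_m -> R[i]) : open U ->
  (forall l, P l -> smooth_on U (f l)) ->
  smooth_on U (fun x => \sum_(l <- s | P l) f l x).
Proof.
move=> oU sf; rewrite -(fct_sumE s P f).
by apply: big_ind => // [|g h]; [exact: smooth_on_cst | exact: smooth_onD].
Qed.

Lemma smooth_on_pderiv U (a : 'I_m) (f : 'rV[R]_m -> R[i]) :
  smooth_on U f -> smooth_on U (pderiv a f).
Proof.
by move=> sf r; have [[_ /(_ a)[_ C1]] [_ /(_ a)[_ C2]]] := sf r.+1.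
Qed.

End SmoothClosure.

(** * Signs in the Grassmann algebra *)

Section GrassmannSigns.
Variables (K : comNzRingType) (k : nat).
Implicit Types (f g : grassmann K k) (b : 'I_k).

Lemma gsignK : involutive (@gsign K k).
Proof. by move=> f; apply/ffunP => A; rewrite !ffunE mulrA -expr2 sqrr_sign mul1r. Qed.

Lemma gsign_scalar (c : K) : gsign (c%:A : grassmann K k) = c%:A.
Proof.
apply/ffunP => A; rewrite ffunE gscaleE goneE; case: eqP => [->|_].
  by rewrite cards0 mul1r.
by rewrite !mulr0.
Qed.

Lemma gsign_theta b : gsign (theta K b) = - theta K b.
Proof.
apply/ffunP => A; rewrite !ffunE; case: eqP => [->|_].
  by rewrite cards1 mulr1 expr1.
by rewrite mulr0 oppr0.
Qed.

Lemma mul_theta f b (C : {set 'I_k}) : (f * theta K b) C =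
  if b \in C then (-1) ^+ inversions (C :\ b) [set b] * f (C :\ b) else 0.
Proof.
rewrite ffunE; case: ifPn => [bC | bNC].
  rewrite (bigD1 (C :\ b)) ?finset.subsetDl //= ffunE.
  rewrite finset.setDDr finset.setDv finset.set0U.
  rewrite (finset.setIidPr _) ?finset.sub1set // eqxx mulr1 big1 ?addr0 // => A.
  case/andP=> sAC neA; rewrite ffunE; case: eqP => [eA | _]; last by rewrite !mulr0.
  case/eqP: neA; rewrite -eA finset.setDDr finset.setDv finset.set0U.
  by rewrite (finset.setIidPr sAC).
rewrite big1 // => A sAC; rewrite ffunE; case: eqP => [eA | _]; last by rewrite !mulr0.
by have := finset.set11 b; rewrite -eA inE (negPf bNC) andbF.
Qed.

(** In each coefficient, the numbers of transpositions that bring theta_b in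
    from the left and from the right add up to the degree of the remaining monomial. *)
Lemma theta_comm f b : theta K b * f = gsign f * theta K b.
Proof.
apply/ffunP => C; rewrite theta_mul mul_theta; case: ifP => // bC.
rewrite ffunE mulrA -exprD -(@inversions1r _ b) ?finset.setD11 // -inversions1l.
by rewrite addnCA addnn exprD -muln2 exprM sqrr_sign mulr1.
Qed.

Lemma gmul_body f g : (f * g) finset.set0 = f finset.set0 * g finset.set0.
Proof.
rewrite ffunE (big_pred1 finset.set0) => [|A]; last by rewrite finset.subset0.
by rewrite finset.setD0 inversions0l mul1r.
Qed.

(** Moving a homogeneous element of parity s past f twists f by s. *)
Definition gtwist (s : bool) f := if s then gsign f else f.

Lemma gtwistK s : involutive (gtwist s).
Proof. by case: s => // f; exact: gsignK. Qed.

Lemma gtwistD s f g : gtwist s (f + g) = gtwist s f + gtwist s g.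
Proof. by case: s => //=; apply/ffunP => A; rewrite !ffunE mulrDr. Qed.

Lemma gtwist0 s : gtwist s (0 : grassmann K k) = 0.
Proof. by case: s => //=; apply/ffunP => A; rewrite !ffunE mulr0. Qed.

Lemma gtwistZ s (c : K) f : gtwist s (c *: f) = c *: gtwist s f.
Proof. by case: s => //=; apply/ffunP => A; rewrite !(ffunE, gscaleE) mulrCA. Qed.

Lemma gtwistM s f g : gtwist s (f * g) = gtwist s f * gtwist s g.
Proof.
case: s => //=; apply/ffunP => C; rewrite !ffunE mulr_sumr.
apply: eq_bigr => A sAC; rewrite !ffunE -(finset.setIidPr sAC) -(finset.cardsID A C).
by rewrite (finset.setIidPr sAC) exprD; ring.
Qed.

End GrassmannSigns.

(** * Superfunctions and coordinate derivations *)

Section Sections.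
Variables (R : realType) (m k : nat) (U : set 'rV[R]_m).
Hypothesis oU : open U.
Implicit Types (F G : superfun R m k) (i j : 'I_(m + k)).
Local Notation z := (@zlow R m k).

Lemma section_cst (c : grassmann R[i] k) : section_on U (fun=> c).
Proof. by move=> A; exact: smooth_on_cst. Qed.

Lemma section_onD F G : section_on U F -> section_on U G -> section_on U (F + G).
Proof.
move=> sF sG A; have := smooth_onD oU (sF A) (sG A).
by congr smooth_on; apply/funext => x; rewrite ffunE.
Qed.

Lemma section_onM F G : section_on U F -> section_on U G -> section_on U (F * G).
Proof.
move=> sF sG A.
have -> : (fun x => (F * G) x A) = fun x =>
    \sum_(C : {set 'I_k} | C \subset A)
      (-1) ^+ inversions C (A :\: C) * (F x C * G x (A :\: C)).
  by apply/funext => x; rewrite ffunE.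
apply: smooth_on_sum => // C _; apply: smooth_onM => //.
  exact: smooth_on_cst.
exact: smooth_onM.
Qed.

Lemma section_onZ (c : R[i]) F : section_on U F -> section_on U (c *: F).
Proof.
move=> sF A; have := smooth_onM oU (smooth_on_cst U c) (sF A).
by congr smooth_on; apply/funext => x; rewrite gscaleE.
Qed.

Lemma section_on_sum (I : Type) (s : seq I) (F : I -> superfun R m k) :
  (forall l, section_on U (F l)) -> section_on U (\sum_(l <- s) F l).
Proof.
by move=> sF; apply: big_ind => //; [exact: section_cst | exact: section_onD].
Qed.

Lemma section_zlow i : section_on U (z i).
Proof.
rewrite /zlow; case: (fintype.split i) => [a|c]; last exact: section_cst.
move=> A; have := smooth_onM oU (smooth_on_coord U a)
  (smooth_on_cst U (A == finset.set0)%:R).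
by congr smooth_on; apply/funext => x; rewrite gscaleE goneE.
Qed.

Lemma section_dup i F : section_on U F -> section_on U (dup i F).
Proof.
move=> sF A; rewrite /dup; case: (fintype.split i) => [a|c].
  have := smooth_on_pderiv a (sF A).
  by congr smooth_on; apply/funext => x; rewrite ffunE.
have [cA|cA] := boolP (c \in A).
  have := smooth_on_cst U 0.
  by congr smooth_on; apply/funext => x; rewrite ffunE cA.
have := smooth_onM oU
  (smooth_on_cst U ((-1) ^+ #|[set a in A | (a < c)%N]|)) (sF (c |: A)).
by congr smooth_on; apply/funext => x; rewrite ffunE (negPf cA).
Qed.

Lemma section_Cderivable F (a : 'I_m) (A : {set 'I_k}) x :
  section_on U F -> U x -> Cderivable a (fun y => F y A) x.
Proof.
move=> sF Ux; have [[_ /(_ a)[d1 _]] [_ /(_ a)[d2 _]]] := sF A 1%N.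
by split; [exact: d1 | exact: d2].
Qed.

(** Locality of the superderivations: as [U] is open, the partial derivatives at
    a point of [U] only see values on [U]. *)
Lemma dup_eq_on i F G x : (forall y, U y -> F y = G y) -> U x ->
  dup i F x = dup i G x.
Proof.
move=> FG Ux; rewrite /dup; case: (fintype.split i) => [a|c]; last by rewrite FG.
apply/ffunP => A; rewrite !ffunE /pderiv; congr (_ +i* _)%C;
  by apply: near_eq_derive; apply: near_eq_on oU Ux _ => y Uy; rewrite FG.
Qed.

Lemma dupD i F G x : section_on U F -> section_on U G -> U x ->
  dup i (F + G) x = dup i F x + dup i G x.
Proof.
move=> sF sG Ux; rewrite /dup; case: (fintype.split i) => [a|c]; apply/ffunP => A.
  have [_ e] := pderivD (section_Cderivable a A sF Ux) (section_Cderivable a A sG Ux).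
  rewrite !ffunE -e; apply: (congr1 (fun h => pderiv a h x)).
  by apply/funext => y; rewrite ffunE.
by rewrite !ffunE; case: ifP => _; rewrite ?addr0 // mulrDr.
Qed.

Lemma dup_scalar i (c : R[i]) x : dup i (fun=> c%:A) x = 0.
Proof.
rewrite /dup; case: (fintype.split i) => [a|b]; last exact: gderiv_scalar.
by apply/ffunP => A; rewrite !ffunE pderiv_cst.
Qed.

Lemma dupZ i (c : R[i]) F x : section_on U F -> U x ->
  dup i (c *: F) x = c *: dup i F x.
Proof.
move=> sF Ux.
have -> : c *: F = (fun=> c%:A) * F.
  by apply/funext => y; rewrite !fctE -scalerAl mul1r.
rewrite (dupM i (section_cst _) sF Ux) dup_scalar mul0r add0r.
by rewrite gsign_scalar if_same -scalerAl mul1r.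
Qed.

Lemma dup_sum i (I : Type) (s : seq I) (F : I -> superfun R m k) x :
  (forall l, section_on U (F l)) -> U x ->
  dup i (\sum_(l <- s) F l) x = \sum_(l <- s) dup i (F l) x.
Proof.
move=> sF Ux; elim: s => [|l s IH].
  by rewrite !big_nil -[RHS](dup_scalar i 0 x) scale0r.
by rewrite !big_cons dupD // ?IH //; exact: section_on_sum.
Qed.

Lemma zlow_comm i x f : z i x * f = gtwist (m <= i)%N f * z i x.
Proof.
rewrite /zlow; case: fintype.splitP => [a ->|c ->].
  by rewrite leqNgt ltn_ord /= -scalerAl -scalerAr mul1r mulr1.
by rewrite leq_addr /= theta_comm.
Qed.

Lemma gtwist_zlow i x s : gtwist s (z i x) = (-1) ^+ (s && (m <= i)%N) *: z i x.
Proof.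
case: s => /=; last by rewrite scale1r.
rewrite /zlow; case: fintype.splitP => [a ->|c ->].
  by rewrite leqNgt ltn_ord /= gsign_scalar scale1r.
by rewrite leq_addr /= gsign_theta scaleN1r.
Qed.

Lemma zlow_body i x : z i x finset.set0 =
  if fintype.split i is inl a then (x 0 a)%:C%C else 0.
Proof.
rewrite /zlow; case: (fintype.split i) => [a|c].
  by rewrite gscaleE goneE eqxx mulr1.
rewrite ffunE; case: eqP => // /setP/(_ c).
by rewrite !inE eqxx.
Qed.

End Sections.

(** * Supersymmetric matrices *)

Section SupersymmetricMatrices.
Variables (F : numFieldType) (m k : nat).
Implicit Types (B : 'M[F]_(m + k)) (i j : 'I_(m + k)).

(** The Koszul sign of a supersymmetric form is (-1)^(|i||j|); it may be written
    with |i| alone because the entries of mixed parity vanish, and in this form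
    the rule is the matrix equation B^T = D B with D the diagonal sign matrix,
    which is stable under inversion. *)
Definition supersymmetric_mx B := forall i j, B j i = (-1) ^+ (m <= i)%N * B i j.

(** Using the sign rule twice gives B i j = - B i j when the parities of i and j
    differ, so the one rule also says that the form is even. *)
Lemma supersymmetric_mx_even B i j : supersymmetric_mx B ->
  B i j != 0 -> (m <= i)%N = (m <= j)%N.
Proof.
move=> sB; apply: contraNeq => ij.
have : B i j = - B i j.
  rewrite {1}sB sB mulrA -signr_addb.
  by case: (m <= i)%N (m <= j)%N ij => [] [] //=; rewrite mulN1r.
by move/eqP; rewrite -addr_eq0 -mulr2n mulrn_eq0.
Qed.

Lemma supersymmetric_invmx B : B \in unitmx ->
  supersymmetric_mx B -> supersymmetric_mx (invmx B).
Proof.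
move=> uB sB; pose D : 'M[F]_(m + k) := diag_mx (\row_i (-1) ^+ (m <= i)%N).
have eB : B^T = D *m B.
  by apply/matrixP => i j; rewrite mul_diag_mx !mxE sB.
have eV : (invmx B)^T *m D = invmx B.
  apply: (can_inj (mulmxK uB)).
  by rewrite mulVmx // -mulmxA -eB -trmx_mul mulmxV // trmx1.
by move=> i j; rewrite -{1}eV mul_mx_diag !mxE mulrC.
Qed.

End SupersymmetricMatrices.

(** * Collecting terms over an algebra *)

(** To compare terms of a contraction, indices may be assumed to be paired by a
    nonzero matrix entry. *)
Lemma scale_congr (F : fieldType) (V : lmodType F) (c : F) (u v : V) :
  (c != 0 -> u = v) -> c *: u = c *: v.
Proof. by have [-> _|_ ->] := eqVneq c 0; rewrite ?scale0r. Qed.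

(** The Laplacian of [R2 * F] with its four kinds of terms separated: the
    supertrace, the two Euler terms (one with indices exchanged, hence the sign
    s and the exchanged weight w') and the Laplacian of [F]. Only linearity is
    involved, so it is stated for arbitrary families in an algebra. *)
Lemma contract_expansion (F : fieldType) (A : algType F) (I : finType)
    (w w' c s : I -> I -> F) (p u v t : I -> I -> A) (f r : A) :
  (forall i j, p i j = (2 * c i j) *: f + (2 * s i j) *: u i j +
                       2 *: v i j + r * t i j) ->
  (forall i j, w' i j = s i j * w i j) ->
  \sum_i \sum_j w i j *: p i j =
  (2 * \sum_i \sum_j w i j * c i j) *: f +
  2 *: (\sum_i \sum_j w' i j *: u i j) + 2 *: (\sum_i \sum_j w i j *: v i j) +
  r * (\sum_i \sum_j w i j *: t i j).
Proof.
move=> pE w'E; rewrite !(mulr_sumr, scaler_sumr, scaler_suml) -!big_split.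
apply: eq_bigr => i _ /=.
rewrite !(mulr_sumr, scaler_sumr, scaler_suml) -!big_split.
apply: eq_bigr => j _ /=; rewrite pE w'E -scalerAr; move: (r * _) => q.
by rewrite !scalerDr !scalerA; congr (_ *: _ + _ *: _ + _ *: _ + _); ring.
Qed.

(** The terms in c are the Euler terms: they come with coefficient 4 from both
    parts of the Bessel operator and cancel. The variable t stands for 2. *)
Lemma bessel_collect (F : comNzRingType) (V : lmodType F) (t lambda s : F)
    (a b c g h : V) :
  - lambda *: (t *: a + b) + t *: (t *: (a + c) + (t *: b + g)) -
    ((t * s) *: a + (t * t) *: c + h) =
  (t * (t - s - lambda)) *: a + (- (lambda - t * t) *: b + t *: g - h).
Proof.
have -> : t * (t - s - lambda) = - lambda * t + t * t - t * s by ring.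
have -> : - (lambda - t * t) = - lambda + t * t by ring.
rewrite !scalerDr !scalerA !(scalerDl, scaleNr) !opprD.
rewrite [LHS](AC ((2*(2*2))*3) ((1*3*7)*((2*5)*6*9)*(4*8))) /=.
by rewrite subrr addr0.
Qed.

Lemma bessel_expansion (F : fieldType) (A : algType F) (lambda s : F)
    (z f r d e ed L Dl El Ll : A) :
  z * r = r * z -> Dl = 2 *: (z * f) + r * d ->
  El = 2 *: (z * f + z * e) + ((2 *: r) * d + r * ed) ->
  Ll = (2 * s) *: f + 4 *: e + r * L ->
  - lambda *: Dl + 2 *: El - z * Ll =
  (2 * (2 - s - lambda)) *: (z * f) +
  r * (- (lambda - 4) *: d + 2 *: ed - z * L).
Proof.
move=> zr -> -> ->; have -> : 4 = 2 * 2 :> F by ring.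
rewrite (mulrBr r) (mulrDr r) 2!(mulrDr z) (mulrA z r L) zr -(mulrA r z L).
rewrite -scalerAl -!scalerAr.
exact: bessel_collect.
Qed.

(** * Bessel operators on multiples of the squared radius *)

Section BesselOperators.
Variables (R : realType) (m k : nat) (U : set 'rV[R]_m).
Hypothesis oU : open U.
Variable beta : 'M[R]_(m + k).
Hypothesis beta_unit : beta \in unitmx.
Hypothesis beta_ss : supersymmetric_mx beta.
Implicit Types (F G : superfun R m k) (i j l : 'I_(m + k)).
Local Notation z := (@zlow R m k).
Local Notation betaV := (invmx beta).
Local Notation w i j := (betaV i j)%:C%C.
Local Notation odd_idx i := (m <= nat_of_ord i)%N.
Local Notation r2 := (@R2 R m k beta).

(** The inverse matrix only pairs indices of equal parity, so each summand of
    a contraction with it is an even expression. *)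
Lemma betaV_even i j : w i j != 0 -> odd_idx i = odd_idx j.
Proof.
rewrite fmorph_eq0.
exact: supersymmetric_mx_even (supersymmetric_invmx beta_unit beta_ss).
Qed.

Lemma dlowE i F x : dlow beta i F x = \sum_j (beta i j)%:C%C *: dup j F x.
Proof. by rewrite /dlow fct_sumE. Qed.

Lemma eulerE F x :
  euler beta F x = \sum_i \sum_j w i j *: (z i x * dlow beta j F x).
Proof.
rewrite /euler fct_sumE exchange_big /=; apply: eq_bigr => j _.
by rewrite fctE /zup fct_sumE mulr_suml; apply: eq_bigr => i _; rewrite scalerAl.
Qed.

Lemma laplacianE F x :
  laplacian beta F x = \sum_i \sum_j w i j *: dlow beta i (dlow beta j F) x.
Proof. by rewrite /laplacian fct_sumE; apply: eq_bigr => i _; rewrite fct_sumE. Qed.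

Lemma R2E x : r2 x = \sum_i \sum_j w i j *: (z i x * z j x).
Proof. by rewrite /R2 fct_sumE; apply: eq_bigr => i _; rewrite fct_sumE. Qed.

Lemma section_R2 : section_on U r2.
Proof.
apply: section_on_sum => // i; apply: section_on_sum => // j.
by apply: section_onZ => //; apply: section_onM => //; exact: section_zlow.
Qed.

Lemma section_dlow i F : section_on U F -> section_on U (dlow beta i F).
Proof.
move=> sF; apply: section_on_sum => // j; apply: section_onZ => //.
exact: section_dup.
Qed.

Lemma section_bessel lambda i F : section_on U F -> section_on U (bessel beta lambda i F).
Proof.
move=> sF; have sdF := section_dlow _ sF.
apply: section_onD => //; first apply: section_onD => //.
- by apply: section_onZ => //.
- apply: section_onZ => //; apply: section_on_sum => // j.
  apply: section_onM => //; last exact: section_dlow.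
  apply: section_on_sum => // l; apply: section_onZ => //; exact: section_zlow.
rewrite -scaleN1r; apply: section_onZ => //; apply: section_onM => //.
  exact: section_zlow.
apply: section_on_sum => // j; apply: section_on_sum => // l.
by apply: section_onZ => //; exact: section_dlow.
Qed.

(* From here on the operators are only used through the rules proved for them;
   unfolded, they are sums over coefficients of Grassmann products. *)
Local Opaque gmul zlow dup dlow euler laplacian R2.

Lemma gtwist_R2 s x : gtwist s (r2 x) = r2 x.
Proof.
rewrite R2E; elim/big_rec: _ => [|i f _ IH]; first exact: gtwist0.
rewrite gtwistD IH; congr (_ + _).
elim/big_rec: _ => [|j g _ {}IH]; first exact: gtwist0.
rewrite gtwistD IH gtwistZ gtwistM !gtwist_zlow.
have [->|/(supersymmetric_mx_even (supersymmetric_invmx beta_unit beta_ss)) ->] :=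
  eqVneq (betaV i j) 0; first by rewrite !scale0r.
rewrite -scalerAl -scalerAr scalerA.
rewrite scalerA -mulrA -expr2 sqrr_sign.
by rewrite mulr1.
Qed.

(** Moving past z_i and z_j twists f twice by the same parity. *)
Lemma R2_central x f : f * r2 x = r2 x * f.
Proof.
rewrite R2E mulr_sumr mulr_suml; apply: eq_bigr => i _.
rewrite mulr_sumr mulr_suml; apply: eq_bigr => j _.
have [->|/(supersymmetric_mx_even (supersymmetric_invmx beta_unit beta_ss)) e] :=
  eqVneq (betaV i j) 0; first by rewrite !scale0r mulr0 mul0r.
rewrite -scalerAl -scalerAr; congr (_ *: _).
rewrite -[RHS]mulrA [z j x * f]zlow_comm [RHS]mulrA [z i x * _ in RHS]zlow_comm.
by rewrite -e gtwistK mulrA.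
Qed.

Lemma dlow_eq_on i F G x : (forall y, U y -> F y = G y) -> U x ->
  dlow beta i F x = dlow beta i G x.
Proof.
move=> FG Ux; rewrite !dlowE; apply: eq_bigr => j _.
by rewrite (dup_eq_on oU _ FG).
Qed.

Lemma dlowD i F G x : section_on U F -> section_on U G -> U x ->
  dlow beta i (F + G) x = dlow beta i F x + dlow beta i G x.
Proof.
move=> sF sG Ux; rewrite !dlowE -big_split; apply: eq_bigr => j _.
by rewrite (dupD _ sF sG Ux) scalerDr.
Qed.

Lemma dlowZ i (c : R[i]) F x : section_on U F -> U x ->
  dlow beta i (c *: F) x = c *: dlow beta i F x.
Proof.
move=> sF Ux; rewrite !dlowE scaler_sumr; apply: eq_bigr => j _.
by rewrite (dupZ _ _ sF Ux) !scalerA mulrC.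
Qed.

Lemma dlow_sum i (I : Type) (s : seq I) (F : I -> superfun R m k) x :
  (forall r : I, section_on U (F r)) -> U x ->
  dlow beta i (\sum_(l <- s) F l) x = \sum_(l <- s) dlow beta i (F l) x.
Proof.
move=> sF Ux; rewrite dlowE; under [RHS]eq_bigr do rewrite dlowE.
rewrite [RHS]exchange_big; apply: eq_bigr => j _.
by rewrite (dup_sum oU _ _ sF Ux) scaler_sumr.
Qed.

Lemma dlow_zlow i j x : dlow beta i (z j) x = (beta i j)%:C%C%:A.
Proof.
rewrite dlowE (bigD1 j) //= big1 ?addr0 => [|l /negPf lj];
  by rewrite dup_zlow natr_dup_zlow ?eqxx ?lj ?scaler0.
Qed.

Lemma dlowM i F G x : section_on U F -> section_on U G -> U x ->
  dlow beta i (F * G) x =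
  dlow beta i F x * G x + gtwist (odd_idx i) (F x) * dlow beta i G x.
Proof.
move=> sF sG Ux; rewrite !dlowE mulr_suml mulr_sumr -big_split.
apply: eq_bigr => j _ /=.
have [->|/(supersymmetric_mx_even beta_ss) e] := eqVneq (beta i j) 0.
  by rewrite !scale0r mul0r mulr0 addr0.
by rewrite (dupM _ sF sG Ux) scalerDr scalerAl scalerAr /gtwist e.
Qed.

Lemma sum_betaV_beta i l : \sum_j betaV i j * beta j l = (i == l)%:R.
Proof. by have /matrixP/(_ i l) := mulVmx beta_unit; rewrite !mxE. Qed.

Lemma sum_beta_betaV i l : \sum_j beta i j * betaV j l = (i == l)%:R.
Proof. by have /matrixP/(_ i l) := mulmxV beta_unit; rewrite !mxE. Qed.

Lemma betaV_swap i j : (-1) ^+ (odd_idx i && odd_idx j) * betaV i j = betaV j i.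
Proof.
have ss := supersymmetric_invmx beta_unit beta_ss.
rewrite [RHS]ss; have [->|/(supersymmetric_mx_even ss) <-] := eqVneq (betaV i j) 0.
  by rewrite !mulr0.
by rewrite andbb.
Qed.

(** The sign is the one picked up when [dlow l] passes the first factor of
    z_i z_j in [R2]. *)
Lemma sum_sign_betaV_beta i l :
  \sum_j (-1) ^+ (odd_idx l && odd_idx i) * (betaV i j * beta l j) = (i == l)%:R.
Proof.
rewrite -sum_betaV_beta; apply: eq_bigr => j _.
have ss := supersymmetric_invmx beta_unit beta_ss.
have [->|/(supersymmetric_mx_even ss) ei] := eqVneq (betaV i j) 0.
  by rewrite !mul0r mulr0.
rewrite [beta l j]beta_ss.
have [->|/(supersymmetric_mx_even beta_ss) el] := eqVneq (beta j l) 0.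
  by rewrite !mulr0.
by rewrite -el ei andbb mulrCA; congr (_ * _); rewrite mulrA -signr_addb addbb mul1r.
Qed.

(** The transposition sign turns the trace of the identity matrix into its
    supertrace. *)
Lemma supertrace_contraction :
  \sum_i \sum_j betaV i j * beta i j = m%:R - k%:R.
Proof.
have sumE i : \sum_j betaV i j * beta i j = (-1) ^+ (odd_idx i).
  transitivity ((-1) ^+ (odd_idx i) * \sum_j (betaV i j * beta j i)).
    rewrite mulr_sumr; apply: eq_bigr => j _; rewrite [beta i j]beta_ss.
    have [->|/(supersymmetric_mx_even beta_ss) ->] := eqVneq (beta j i) 0.
      by rewrite !mulr0.
    by rewrite mulrCA.
  by rewrite sum_betaV_beta eqxx mulr1.
under eq_bigr do rewrite sumE.
rewrite big_split_ord /=; congr (_ + _).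
  under eq_bigr => i _ do rewrite leqNgt ltn_ord expr0.
  by rewrite sumr_const card_ord.
under eq_bigr => i _ do rewrite leq_addr expr1.
by rewrite sumr_const card_ord mulNrn.
Qed.

Lemma sum_delta (V : lmodType R[i]) (c : 'I_(m + k) -> R) l (v : 'I_(m + k) -> V) :
  (forall i, c i = (i == l)%:R) -> \sum_i (c i)%:C%C *: v i = v l.
Proof.
move=> ce; rewrite (bigD1 l) //= big1 ?addr0 => [|i /negPf il].
  by rewrite ce eqxx scale1r.
by rewrite ce il scale0r.
Qed.

(** Both factors of the quadratic expression contribute z_l once, the second one
    thanks to supersymmetry. *)
Lemma dlow_R2 l x : U x -> dlow beta l r2 x = 2 *: z l x.
Proof.
move=> Ux; have sz := section_zlow oU.
have szz i j := section_onM oU (sz k i) (sz k j).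
have swz i j := section_onZ oU (w i j) (szz i j).
have ssz i := section_on_sum oU (index_enum 'I_(m + k)) (swz i).
rewrite dlow_sum //.
under eq_bigr => i _.
  rewrite dlow_sum //; under eq_bigr => j _.
    rewrite dlowZ // dlowM // !dlow_zlow gtwist_zlow -!scalerAl mul1r -scalerAr.
    rewrite mulr1 scalerDr !scalerA -!rmorphM.
    over.
  rewrite big_split /=; over.
rewrite big_split /= scaler_nat mulr2n; congr (_ + _).
  rewrite exchange_big /=; under eq_bigr => j _ do rewrite -scaler_suml -rmorph_sum.
  apply: sum_delta => j; rewrite eq_sym -sum_beta_betaV.
  by apply: eq_bigr => i _; rewrite mulrC.
under eq_bigr => i _.
  under eq_bigr => j _ do rewrite -(rmorph_sign (real_complex R)) -!rmorphM.
  rewrite -scaler_suml -rmorph_sum; over.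
apply: sum_delta => i; rewrite -sum_sign_betaV_beta.
by apply: eq_bigr => j _; ring.
Qed.

Lemma dlow_R2M l F x : section_on U F -> U x ->
  dlow beta l (r2 * F) x = 2 *: (z l x * F x) + r2 x * dlow beta l F x.
Proof.
move=> sF Ux; have sr := section_R2.
by rewrite dlowM // dlow_R2 // gtwist_R2 scalerAl.
Qed.

Lemma euler_eq_on F G x : (forall y, U y -> F y = G y) -> U x ->
  euler beta F x = euler beta G x.
Proof.
move=> FG Ux; rewrite !eulerE; apply: eq_bigr => i _; apply: eq_bigr => j _.
by rewrite (dlow_eq_on _ FG).
Qed.

Lemma eulerD F G x : section_on U F -> section_on U G -> U x ->
  euler beta (F + G) x = euler beta F x + euler beta G x.
Proof.
move=> sF sG Ux; rewrite !eulerE -big_split; apply: eq_bigr => i _.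
by rewrite -big_split; apply: eq_bigr => j _; rewrite dlowD // mulrDr scalerDr.
Qed.

Lemma eulerZ (c : R[i]) F x : section_on U F -> U x ->
  euler beta (c *: F) x = c *: euler beta F x.
Proof.
move=> sF Ux; rewrite !eulerE scaler_sumr; apply: eq_bigr => i _.
rewrite scaler_sumr; apply: eq_bigr => j _.
by rewrite dlowZ // -scalerAr !scalerA mulrC.
Qed.

(** The Euler field is even: moving z^i back across the factor [F], which the odd
    derivation has twisted, removes the twist. *)
Lemma eulerM F G x : section_on U F -> section_on U G -> U x ->
  euler beta (F * G) x = euler beta F x * G x + F x * euler beta G x.
Proof.
move=> sF sG Ux; rewrite !eulerE mulr_suml mulr_sumr -big_split.
apply: eq_bigr => i _; rewrite mulr_suml mulr_sumr -big_split.
apply: eq_bigr => j _ /=.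
rewrite -scalerAl -scalerAr -scalerDr; apply: scale_congr => e.
rewrite dlowM // mulrDr [in X in _ + X]mulrA [z i x * gtwist _ _]zlow_comm.
by rewrite (betaV_even e) gtwistK !mulrA.
Qed.

Lemma euler_zlow l x : euler beta (z l) x = z l x.
Proof.
rewrite eulerE; under eq_bigr => i _.
  under eq_bigr => j _ do rewrite dlow_zlow -scalerAr mulr1 scalerA -rmorphM.
  rewrite -scaler_suml -rmorph_sum; over.
by apply: sum_delta => i; rewrite sum_betaV_beta.
Qed.

Lemma euler_R2 x : U x -> euler beta r2 x = 2 *: r2 x.
Proof.
move=> Ux; rewrite eulerE R2E scaler_sumr; apply: eq_bigr => i _.
rewrite scaler_sumr; apply: eq_bigr => j _.
by rewrite dlow_R2 // -scalerAr !scalerA mulrC.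
Qed.

(** The coefficient 2 (m - k) is the Laplacian of [R2]; the cross terms of the
    Leibniz rule are Euler fields, one of them after exchanging the indices. *)
Lemma laplacian_R2M F x : section_on U F -> U x ->
  laplacian beta (r2 * F) x =
  (2 * (m%:R - k%:R)) *: F x + 4 *: euler beta F x + r2 x * laplacian beta F x.
Proof.
move=> sF Ux; have sz := section_zlow oU.
have sdF j := section_dlow j sF.
have szF j := section_onM oU (sz k j) sF.
have srd j := section_onM oU section_R2 (sdF j).
have s2zF j := section_onZ oU 2 (szF j).
have dlow2E i j : dlow beta i (dlow beta j (r2 * F)) x =
    (2 * (beta i j)%:C%C) *: F x +
    (2 * (-1) ^+ (odd_idx i && odd_idx j)) *: (z j x * dlow beta i F x) +
    2 *: (z i x * dlow beta j F x) + r2 x * dlow beta i (dlow beta j F) x.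
  transitivity (dlow beta i (2 *: (z j * F) + r2 * dlow beta j F) x).
    by apply: dlow_eq_on => // y Uy; rewrite dlow_R2M.
  rewrite dlowD // dlowZ // dlowM // dlow_R2M // dlow_zlow gtwist_zlow.
  rewrite mulr_algl -scalerAl.
  move: (F x) (z j x * _) (z i x * _) (r2 x * _) => f u v t.
  by rewrite scalerDr !scalerA !addrA.
have wswap i j : w j i = (-1) ^+ (odd_idx i && odd_idx j) * w i j.
  by rewrite -(betaV_swap i j) (rmorphM (real_complex R)) rmorph_sign.
rewrite laplacianE (contract_expansion dlow2E wswap).
have -> : \sum_i \sum_j w i j * (beta i j)%:C%C = m%:R - k%:R.
  rewrite -!(rmorph_nat (real_complex R)) -rmorphB -supertrace_contraction.
  rewrite rmorph_sum; apply: eq_bigr => i _; rewrite rmorph_sum.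
  by apply: eq_bigr => j _; rewrite rmorphM.
rewrite -laplacianE -eulerE exchange_big -eulerE.
by rewrite (_ : 4 = 2 + 2) ?scalerDl ?addrA //; ring.
Qed.

(** The key identity. The parameter of the second Bessel operator drops by 4
    because the Euler field acts on the factor [R2], of degree 2, with weight 2
    and enters the Bessel operator with the factor 2. *)
Lemma bessel_R2M lambda l F x : section_on U F -> U x ->
  bessel beta lambda l (r2 * F) x =
  (2 * (2 - (m%:R - k%:R) - lambda)) *: (z l x * F x) +
  r2 x * bessel beta (lambda - 4) l F x.
Proof.
move=> sF Ux; have sr := section_R2; have sz := section_zlow oU (k := k).
have sdF := section_dlow l sF.
have szF := section_onM oU (sz l) sF.
have srd := section_onM oU section_R2 sdF.
have s2zF := section_onZ oU 2 szF.
have eulerE' : euler beta (dlow beta l (r2 * F)) x =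
    2 *: (z l x * F x + z l x * euler beta F x) +
    ((2 *: r2 x) * dlow beta l F x + r2 x * euler beta (dlow beta l F) x).
  transitivity (euler beta (2 *: (z l * F) + r2 * dlow beta l F) x).
    by apply: euler_eq_on => // y Uy; rewrite dlow_R2M.
  by rewrite eulerD // eulerZ // !eulerM // euler_zlow euler_R2.
exact: (bessel_expansion _ (R2_central x (z l x)) (dlow_R2M l sF Ux) eulerE'
  (laplacian_R2M sF Ux)).
Qed.

End BesselOperators.

(** * The ideal of the minimal orbit *)

Section MinimalOrbit.
Variables (R : realType) (m k : nat) (U : set 'rV[R]_m).
Hypothesis oU : open U.
Variable beta : 'M[R]_(m + k).
Hypothesis beta_unit : beta \in unitmx.
Hypothesis beta_ss : supersymmetric_mx beta.
Implicit Types (F G : superfun R m k) (l : 'I_(m + k)).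
Local Notation r2 := (@R2 R m k beta).

Local Opaque gmul zlow dup dlow euler laplacian R2.

(** Centrality of [R2] gathers the two-sided combinations into one multiple. *)
Lemma in_ideal_R2P F : in_ideal_on U r2 F <->
  section_on U F /\
  exists2 G, section_on U G & forall x, U x -> F x = r2 x * G x.
Proof.
split=> [[sF [r [A [B [sAB FE]]]]]|[sF [G sG FE]]]; split=> //.
  exists (\sum_l A l * B l).
    by apply: section_on_sum => // l; have [] := sAB l; exact: section_onM.
  move=> x Ux; rewrite FE // !fct_sumE mulr_sumr; apply: eq_bigr => l _.
  by rewrite !fctE R2_central // mulrA.
exists 1%N, (fun=> 1), (fun=> G); split.
  by move=> _; split=> //; exact: section_cst.
by move=> x Ux; rewrite big_ord1 mul1r FE.
Qed.

Lemma bessel_eq_on lambda l F G x : (forall y, U y -> F y = G y) -> U x ->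
  bessel beta lambda l F x = bessel beta lambda l G x.
Proof.
move=> FG Ux.
have dFG i y : U y -> dlow beta i F y = dlow beta i G y.
  exact: (dlow_eq_on oU beta i FG).
have eE : euler beta (dlow beta l F) x = euler beta (dlow beta l G) x.
  exact: (euler_eq_on oU beta (dFG l) Ux).
have eL : laplacian beta F x = laplacian beta G x.
  rewrite !laplacianE; apply: eq_bigr => i _.
  apply: eq_bigr => j _.
  exact: (congr1 (GRing.scale _) (dlow_eq_on oU beta i (dFG j) Ux)).
have combine (c : R[i]) (v D D' E E' L L' : grassmann R[i] k) :
    D = D' -> E = E' -> L = L' ->
    c *: D + 2 *: E - v * L = c *: D' + 2 *: E' - v * L' by move=> -> -> ->.
exact: combine (dFG l x Ux) eE eL.
Qed.

Lemma bessel_tangential l F :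
  in_ideal_on U r2 F -> in_ideal_on U r2 (bessel beta (2 - (m%:R - k%:R)) l F).
Proof.
case/in_ideal_R2P=> sF [G sG FE]; apply/in_ideal_R2P; split.
  exact: section_bessel.
exists (bessel beta (2 - (m%:R - k%:R) - 4) l G); first exact: section_bessel.
move=> x Ux; rewrite (bessel_eq_on _ _ (G := r2 * G)) // (bessel_R2M oU) //.
by rewrite subrr mulr0 scale0r add0r.
Qed.

(** At a point of the cone, the body of the key identity for F = 1 reads
    2 (2 - M - lambda) x_a = 0. *)
Lemma tangential_parameter lambda (a : 'I_m) x : U x -> x 0 a != 0 ->
  r2 x finset.set0 = 0 ->
  in_ideal_on U r2 (bessel beta lambda (lshift k a) r2) ->
  lambda = 2 - (m%:R - k%:R).
Proof.
move=> Ux xa r0 /in_ideal_R2P[_ [G _ /(_ x Ux)]].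
have s1 : section_on U (1 : superfun R m k) by exact: section_cst.
rewrite -{1}[r2]mulr1 (bessel_R2M oU) // mulr1.
move=> /(congr1 (fun f : grassmann R[i] k => f finset.set0)).
rewrite ffunE gscaleE !gmul_body r0 !mul0r addr0 zlow_body.
rewrite (unsplitK (inl a : 'I_m + 'I_k)%type).
move=> /eqP; rewrite mulf_eq0 => /orP[|]; last first.
  by rewrite (fmorph_eq0 (real_complex R)) (negPf xa).
by rewrite mulf_eq0 pnatr_eq0 /= subr_eq0 => /eqP.
Qed.

End MinimalOrbit.

(** * The Gram matrix and a null point *)

Section Gram.
Variables (R : realType) (J : superspace R) (b : {biscalar J}).
Hypothesis b_supersym : supersymmetric b.
Hypothesis b_even : even_form b.
Hypothesis b_nondeg : nondegenerate_form b.
Variables (m k : nat) (e : (m + k).-tuple J).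
Hypothesis he : homogeneous_basis e.
Local Notation beta := (gram b e).

Lemma gram_supersymmetric : supersymmetric_mx beta.
Proof.
move=> i j; rewrite !mxE; have [_ par] := he.
rewrite (b_supersym (par j) (par i)).
have [->|ij] := eqVneq (m <= j)%N (m <= i)%N; first by rewrite andbb.
by rewrite (b_even (par i) (par j)) ?mulr0 // eq_sym.
Qed.

Lemma basis_expansion u : u = \sum_i coord e i u *: tnth e i.
Proof.
have [be _] := he; rewrite {1}(coord_basis be (memvf u)).
by apply: eq_bigr => i _; rewrite (tnth_nth 0).
Qed.

(** A row vector in the kernel of the Gram matrix is the coordinate vector of an
    element in the left radical. *)
Lemma gram_unit : beta \in unitmx.
Proof.
rewrite -row_free_unit; apply: inj_row_free => c cB.
have [be _] := he.
pose u := \sum_i c 0 i *: tnth e i.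
have u0 : u = 0.
  apply: b_nondeg => v; rewrite (basis_expansion v) linear_sumr big1 // => j _.
  rewrite linearZr_LR /= (_ : b u (tnth e j) = (c *m beta) 0 j).
    by rewrite cB mxE mulr0.
  rewrite linear_sumlz mxE; apply: eq_bigr => i _.
  by rewrite linearZl_LR mxE.
have /freeP fe := basis_free be.
apply/rowP => i; rewrite [RHS]mxE; apply: (fe (fun i => c 0 i)).
by rewrite -[RHS]u0; apply: eq_bigr => j _; rewrite (tnth_nth 0).
Qed.

(** Adding basis vectors of square 1 and -1 gives a null vector u. The point with
    coordinates b(e_i, u) works: these are the coordinates of u lowered by the
    Gram matrix, so the inverse matrix in [R2] turns them back and [R2] takes
    the value b(u, u). *)
Lemma null_point r s : signature b (hpart J false) r.+1 s.+1 ->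
  exists2 x : 'rV[R]_m, x != 0 & R2 beta x finset.set0 = 0.
Proof.
case=> f bf fE; have [be par] := he.
pose i0 : 'I_(r.+1 + s.+1) := lshift s.+1 ord0.
pose i1 : 'I_(r.+1 + s.+1) := rshift r.+1 ord0.
have i01 : i0 != i1 by rewrite eq_lrshift.
pose u := tnth f i0 + tnth f i1.
have fJ i : tnth f i \in hpart J false by apply: (basis_mem bf); exact: mem_tnth.
have uJ : u \in hpart J false by exact: memvD.
have vu : b (tnth f i0) u = 1.
  by rewrite linearDr /= !fE eqxx (negPf i01) addr0.
have uu : b u u = 0.
  rewrite linearDl vu linearDr /= !fE eq_sym (negPf i01) eqxx.
  by rewrite /= addn0 ltnn add0r subrr.
pose X i := b (tnth e i) u.
have Xodd c : X (rshift m c) = 0.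
  by apply: (b_even (par _) uJ); rewrite /= leq_addr.
have XE i : X i = \sum_j beta i j * coord e j u.
  rewrite /X {1}(basis_expansion u) linear_sumr; apply: eq_bigr => j _.
  by rewrite linearZr_LR /= mxE mulrC.
have coordE i : coord e i u = \sum_j invmx beta i j * X j.
  under eq_bigr => j _ do rewrite XE mulr_sumr.
  rewrite exchange_big /=; under eq_bigr => l _.
    under eq_bigr => j _ do rewrite mulrA.
    rewrite -mulr_suml sum_betaV_beta ?gram_unit //; over.
  rewrite (bigD1 i) //= eqxx mul1r big1 ?addr0 // => l li.
  by rewrite eq_sym (negPf li) mul0r.
exists (\row_a X (lshift k a)).
  (* Otherwise u pairs to zero with the whole basis, but it pairs to 1 with the
     vector [tnth f i0] of square 1. *)
  apply/eqP => /rowP x0; have X0 i : X i = 0.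
    by case: (split_ordP i) => [a ->|c -> //]; have := x0 a; rewrite !mxE.
  move: vu => /eqP; rewrite (basis_expansion (tnth f i0)) linear_sumlz big1.
    by rewrite eq_sym oner_eq0.
  by move=> i _; rewrite linearZl_LR /= -/(X i) X0 mulr0.
have zX i : zlow i (\row_a X (lshift k a)) finset.set0 = (X i)%:C%C.
  rewrite zlow_body; case: split_ordP => [a ->|c ->]; first by rewrite mxE.
  by rewrite Xodd rmorph0.
rewrite R2E sum_ffunE; under eq_bigr => i _.
  rewrite sum_ffunE; under eq_bigr => j _.
    rewrite gscaleE gmul_body !zX -!(rmorphM (real_complex R)) mulrCA; over.
  rewrite -(rmorph_sum (real_complex R)) -mulr_sumr -coordE; over.
rewrite -(rmorph_sum (real_complex R)).
suff -> : \sum_i X i * coord e i u = 0 by rewrite rmorph0.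
transitivity (b (\sum_i coord e i u *: tnth e i) u); last first.
  by rewrite -basis_expansion.
rewrite linear_sumlz; apply: eq_bigr => i _.
by rewrite linearZl_LR /= mulrC.
Qed.

End Gram.

(** * Tangentiality *)

Lemma open_punctured_space (R : realType) m :
  open [set x : 'rV[R]_m | x != 0].
Proof.
rewrite (_ : mkset _ = ~` [set 0]).
  apply: closed_openC; apply: accessible_closed_set1.
  by apply: hausdorff_accessible; exact: norm_hausdorff.
by apply/seteqP; split=> x /= /eqP.
Qed.

Theorem proposition4p10 (R : realType) (p q n : nat)
  (hp : (2 <= p)%N) (hq : (2 <= q)%N)
  (J : superspace R)
  (hJ0 : \dim (hpart J false) = (p + q - 2)%N)
  (hJ1 : \dim (hpart J true) = (2 * n)%N)
  (b : {biscalar J})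
  (b_supersym : supersymmetric b) (b_even : even_form b)
  (b_nondeg : nondegenerate_form b)
  (b_sig : signature b (hpart J false) (p - 1) (q - 1))
  (e : ((p + q - 2) + 2 * n).-tuple J) (he : homogeneous_basis e)
  (M : int) (hM : M = p%:Z + q%:Z - 2 - 2 * n%:Z)
  (lambda : R[i]) :
  let beta := gram b e in
  let U := [set x : 'rV[R]_(p + q - 2) | x != 0] in
  (forall (k : 'I_((p + q - 2) + 2 * n))
          (F : superfun R (p + q - 2) (2 * n)),
     in_ideal_on U (R2 beta) F ->
     in_ideal_on U (R2 beta) (bessel beta lambda k F))
  <-> lambda = 2 - M%:~R.
Proof.
move=> beta U.
have oU : open U by exact: open_punctured_space.
have ss : supersymmetric_mx beta by exact: gram_supersymmetric.
have ub : beta \in unitmx by exact: gram_unit.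
have MR : M%:~R = (p + q - 2)%:R - (2 * n)%:R :> R[i].
  have pq : (2 <= p + q)%N by exact: leq_trans hp (leq_addr _ _).
  by rewrite hM !intrB intrD intrM -!pmulrn natrB // natrD natrM.
split=> [tangent|-> l F]; last by rewrite MR; exact: bessel_tangential.
have predS t : (2 <= t)%N -> exists r, (t - 1)%N = r.+1.
  by case: t => [|[|r]] // _; exists r; rewrite subn1.
have [[r pr] [s qs]] := (predS p hp, predS q hq).
rewrite pr qs in b_sig.
have [x x0 r0] := null_point b_even b_nondeg he b_sig.
have /rV0Pn[a xa] := x0.
rewrite MR; apply: (tangential_parameter oU ub ss x0 xa r0).
apply: tangent; apply/(in_ideal_R2P oU ub ss); split; first exact: section_R2.
exists 1; first exact: section_cst.
by move=> y _; exact: esym (mulr1 _).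
Qed.
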